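(* Let $U_i^{\min}\le U_i^{\max}$, $i=1,\dots,N$, be prescribed bounds, and assume that the low-order solution satisfies $U_i^{\min}\le U_i^{L,n+1}\le U_i^{\max}$ for all $i$. Then the limited solution $$U_i^{n+1}=U_i^{L,n+1}+\frac{\Delta t^n}{m_i}\sum_{j\in\mathcal{I}(S_i)}l_{ij}^n t_{ij}^n+\frac{\Delta t^n}{m_i}\alpha_i^n l_i^n$$ remains within the same bounds, i.e. $U_i^{\min}\le U_i^{n+1}\le U_i^{\max}$ for all $i=1,\dots,N$. In particular, when $l_i^n=0$ for all $i=1,\dots,N$, the same result holds for the flux-corrected transport update $U_i^{n+1}=U_i^{L,n+1}+\frac{\Delta t^n}{m_i}\sum_{j\in\mathcal{I}(S_i)}l_{ij}^nt_{ij}^n$ (the coefficients $l_{ij}^n$ then being computed with $Q_i^{+}=\frac{m_i}{\Delta t^n}(U_i^{\max}-U_i^{L,n+1})$ and $Q_i^{-}=\frac{m_i}{\Delta t^n}(U_i^{\min}-U_i^{L,n+1})$).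
   Context: Mesh and space. $\Omega\subset\mathbb{R}^2$ is an open (bounded) polygonal domain with outward unit normal $\mathbf{n}$, and $\mathcal{K}_h$ is a triangulation of $\Omega$ without hanging nodes. $\mathcal{F}_h^{\mathrm{int}}$ is the set of interior edges, and $\mathbf{x}_1,\dots,\mathbf{x}_N$ are the midpoints of all edges. For each edge $F$ a unit normal $\mathbf{n}_F$ is fixed; for a piecewise polynomial $v$ put $v^{\mp}(\mathbf{x})=\lim_{\epsilon\to0^+}v(\mathbf{x}\mp\epsilon\mathbf{n}_F)$ on $F$ and $[\![v]\!]=v^+-v^-$. The Crouzeix-Raviart space is the set of functions $v_h$ that are affine on each triangle and satisfy $\int_F[\![v_h]\!]\,\mathrm{d}s=0$ for all $F\in\mathcal{F}_h^{\mathrm{int}}$, with basis $\varphi_1,\dots,\varphi_N$, $\varphi_i(\mathbf{x}_j)=\delta_{ij}$. $S_i$ is the support of $\varphi_i$, $S_{ij}=S_i\cap S_j$, $\mathcal{I}(E)=\{j:|S_j\cap E|\ne0\}$ for a union of cells $E$; $m_i=\frac13|S_i|$ and $M=\mathrm{diag}(m_1,\dots,m_N)$. Matrices. $\boldsymbol{\beta}$ is a bounded velocity field with traces on edges (single-valued $\boldsymbol{\beta}\cdot\mathbf{n}_F$), evaluated at $t=t^n$. With $\mathbf{n}$ on $\partial K$ the unit normal outward to $K$ and functions on $\partial K$ being traces from inside $K$, $$a_h(u_h,v_h)=\sum_{K}\int_K(\boldsymbol{\beta}\cdot\nabla u_h)v_h\,\mathrm{d}\mathbf{x},$$ $$b_h(u_h,v_h)=\sum_{K}\int_{\partial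 K\setminus\partial\Omega}\boldsymbol{\beta}\cdot\mathbf{n}\,u_hv_h\,\mathrm{d}s-\sum_{F\in\mathcal{F}_h^{\mathrm{int}}}\int_F\bigl(u_h^-\max(0,\boldsymbol{\beta}\cdot\mathbf{n}_F)+u_h^+\min(0,\boldsymbol{\beta}\cdot\mathbf{n}_F)\bigr)(-[\![v_h]\!])\,\mathrm{d}s,$$ and $S^n=(s_{ij}^n)$, $s_{ij}^n=a_h(\varphi_j,\varphi_i)-b_h(\varphi_j,\varphi_i)$. The low-order viscosity $V^{L,n}=(v_{ij}^{L,n})$ is either the minimum viscosity, $v_{ij}^{L,n}=\max(0,s_{ij}^n,s_{ji}^n)$ for $i\ne j$, or the bilinear viscosity, $v_{ij}^{L,n}=\max\bigl(0,\max_{l,k\in\mathcal{I}(S_{ij}),\,l\ne k}s_{lk}^n\bigr)$ for $i\ne j$ (equal to $0$ if $|S_{ij}|=0$); in both cases $v_{ii}^{L,n}=-\sum_{j\ne i}v_{ij}^{L,n}$. Inflow term. $\partial\Omega^-=\{\mathbf{x}\in\partial\Omega:\boldsymbol{\beta}\cdot\mathbf{n}<0\}$, $u_{\mathrm{in}}$ is the inflow datum, $u_h^n=\sum_iU_i^n\varphi_i$, and $$l_i^n=\int_{\partial\Omega^-}\boldsymbol{\beta}\cdot\mathbf{n}\,(u_h^n-u_{\mathrm{in}})\varphi_i\,\mathrm{d}s .$$ Low-order solution and limiter. Given $U^n\in\mathbb{R}^N$ and $\Delta t^n>0$: $$U^{L,n+1}=\bigl(I-\Delta t^nM^{-1}(S^n-V^{L,n})\bigr)U^n,\qquad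 t_{ij}^n=-v_{ij}^{L,n}(U_j^n-U_i^n),$$ $$\alpha_i^n=\min\Bigl\{1,\max\Bigl\{0,\ \frac{m_i}{\Delta t^n}\frac{U_i^{\max}-U_i^{L,n+1}}{l_i^n},\ \frac{m_i}{\Delta t^n}\frac{U_i^{\min}-U_i^{L,n+1}}{l_i^n}\Bigr\}\Bigr\}\ \text{ if } l_i^n\neq0,\qquad \alpha_i^n=1\ \text{ otherwise},$$ $$P_i^+=\sum_{j\in\mathcal{I}(S_i)}\max\{0,t_{ij}^n\},\qquad P_i^-=\sum_{j\in\mathcal{I}(S_i)}\min\{0,t_{ij}^n\},$$ $$Q_i^+=\frac{m_i}{\Delta t^n}(U_i^{\max}-U_i^{L,n+1})-\alpha_i^nl_i^n,\qquad Q_i^-=\frac{m_i}{\Delta t^n}(U_i^{\min}-U_i^{L,n+1})-\alpha_i^nl_i^n,$$ $R_i^{\pm}=\min\{1,Q_i^{\pm}/P_i^{\pm}\}$ if $P_i^{\pm}\ne0$ and $R_i^{\pm}=1$ otherwise, and $$l_{ij}^n=\min\{R_i^+,R_j^-\}\ \text{ if } t_{ij}^n\ge0,\qquad l_{ij}^n=\min\{R_i^-,R_j^+\}\ \text{ otherwise}.$$ *)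

(* Defs.v *)
From HB Require Import structures.
From mathcomp Require Import all_boot all_order all_algebra.
From mathcomp Require Import all_classical all_reals all_analysis.
Set Implicit Arguments.
Unset Strict Implicit.
Unset Printing Implicit Defensive.
Import Order.TTheory GRing.Theory Num.Theory.
Import numFieldNormedType.Exports.
Local Open Scope classical_set_scope.
Local Open Scope ring_scope.

Section Plane.
Variable R : realType.
Implicit Types (p q x n : R * R) (A : set (R * R)).

Definition dot p q : R := p.1 * q.1 + p.2 * q.2.

Definition enorm p : R := Num.sqrt (dot p p).

(* [x + e n] *)
Definition shift x (e : R) n : R * R := (x.1 + e * n.1, x.2 + e * n.2).

Definition opp n : R * R := (- n.1, - n.2).

Definition seg p q (t : R) : R * R := shift p t (shift q (-1) p).

Definition frontier A : set (R * R) := closure A `\` interior A.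

Definition area A : \bar R := (@lebesgue_measure R \x @lebesgue_measure R)%E A.

(* The trace at [x] of a function defined on the side of [x] from which the
   vector [n] points outward: lim_(e -> 0+) v (x - e n). *)
Definition trace n (v : R * R -> R) x : R :=
  lim (v (shift x (- e) n) @[e --> 0^'+]).

Definition grad (v : R * R -> R) x : R * R :=
  (derive1 (fun s => v (s, x.2)) x.1, derive1 (fun s => v (x.1, s)) x.2).

(* The condition [interior (closure A) = A] rules out slits, along which there
   would be no outward normal. *)
Definition polygonal_domain A : Prop :=
  [/\ open A, connected A, A !=set0, bounded_set A &
      interior (closure A) = A /\
      exists s : seq ((R * R) * (R * R)),
        frontier A = [set x | exists2 pq, pq \in s &
                              exists2 t, t \in `[0, 1] & x = seg pq.1 pq.2 t]].

End Plane.

(* A triangle is given by the set of its three vertices, an edge by a pair of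
   distinct vertices (in an arbitrary order); the edges are numbered by
   ['I_(nbe T)] and carry a chosen normal. *)
Record mesh (R : realType) := Mesh {
  domain : set (R * R);
  nbv : nat;
  nbe : nat;
  vertex : 'I_nbv -> R * R;
  cells : {set {set 'I_nbv}};
  edge : 'I_nbe -> 'I_nbv * 'I_nbv;
  normal : 'I_nbe -> R * R }.

Section Mesh.
Variables (R : realType) (T : mesh R).
Implicit Types (K : {set 'I_(nbv T)}) (F i j : 'I_(nbe T)).
Implicit Types (u v : R * R -> R) (x : R * R).

(* Convex hull of the vertices indexed by [K]. *)
Definition hull K : set (R * R) :=
  [set x | exists w : 'I_(nbv T) -> R,
     [/\ forall a, a \in K -> 0 <= w a, \sum_(a in K) w a = 1 &
         x = (\sum_(a in K) w a * (vertex a).1,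
              \sum_(a in K) w a * (vertex a).2)]].

Definition open_cell K : set (R * R) := interior (hull K).

Definition affinely_independent K : Prop :=
  forall w : 'I_(nbv T) -> R,
    \sum_(a in K) w a = 0 ->
    \sum_(a in K) w a * (vertex a).1 = 0 ->
    \sum_(a in K) w a * (vertex a).2 = 0 ->
    forall a, a \in K -> w a = 0.

Definition edge_set F : {set 'I_(nbv T)} := [set (edge F).1; (edge F).2].

Definition edge_vector F : R * R :=
  shift (vertex (edge F).2) (-1) (vertex (edge F).1).

Definition edge_point F (t : R) : R * R :=
  seg (vertex (edge F).1) (vertex (edge F).2) t.

Definition midpoint F : R * R := edge_point F 2^-1.

(* The intersection property is the absence of hanging nodes: two triangles
   meet in the convex hull of their common vertices. *)
Definition triangulation : Prop :=
  polygonal_domain (domain T) /\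
  [/\ injective (@vertex R T),
      forall K, K \in cells T -> #|K| = 3 /\ affinely_independent K,
      forall K K', K \in cells T -> K' \in cells T ->
        hull K `&` hull K' = hull (K :&: K') &
      closure (domain T) = [set x | exists2 K, K \in cells T & hull K x]] /\
  [/\ forall F, (edge F).1 != (edge F).2,
      forall F, exists2 K, K \in cells T & edge_set F \subset K,
      forall K a b, K \in cells T -> a \in K -> b \in K -> a != b ->
        exists F, edge_set F = [set a; b]%SET,
      injective edge_set &
      forall F, enorm (normal F) = 1 /\ dot (normal F) (edge_vector F) = 0].

Definition boundary_edge F : bool :=
  `[< hull (edge_set F) `<=` frontier (domain T) >].

Definition interior_edge F : bool := ~~ boundary_edge F.

Definition centroid K : R * R :=
  (#|K|%:R^-1 * \sum_(a in K) (vertex a).1,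
   #|K|%:R^-1 * \sum_(a in K) (vertex a).2).

(* Unit normal on [F], outward to the triangle [K] having [F] as an edge. *)
Definition outward K F : R * R :=
  if 0 < dot (normal F) (shift (midpoint F) (-1) (centroid K))
  then normal F else opp (normal F).

Definition int_cell K (f : R * R -> R) : R :=
  Rintegral (@lebesgue_measure R \x @lebesgue_measure R)%E (open_cell K) f.

(* Arc length integral of [f] over the part of the edge [F] lying in [A]. *)
Definition int_edge_on F (A : set (R * R)) (f : R * R -> R) : R :=
  enorm (edge_vector F) *
  Rintegral (@lebesgue_measure R) (`]0, 1[ `&` edge_point F @^-1` A)
    (f \o edge_point F).

Definition int_edge F (f : R * R -> R) : R := int_edge_on F setT f.

Definition vminus F v x : R := trace (normal F) v x.

Definition vplus F v x : R := trace (opp (normal F)) v x.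

Definition jump F v x : R := vplus F v x - vminus F v x.

(* Elements are functions on the plane whose values on the edges and outside
   the domain are irrelevant: only the open triangles and the one-sided traces
   on the edges are used, here and below. *)
Definition crouzeix_raviart v : Prop :=
  (forall K, K \in cells T -> exists a b c : R,
     forall x, open_cell K x -> v x = a + b * x.1 + c * x.2) /\
  (forall F, interior_edge F -> int_edge F (jump F v) = 0).

(* The value of [phi i] at a midpoint is that of its traces there; these
   coincide, as an affine jump with zero mean vanishes at the midpoint. *)
Definition cr_basis (phi : 'I_(nbe T) -> R * R -> R) : Prop :=
  (forall i, crouzeix_raviart (phi i)) /\
  (forall i j K, K \in cells T -> edge_set j \subset K ->
     trace (outward K j) (phi i) (midpoint j) = (i == j)%:R).

Definition support v : set (R * R) :=
  closure [set x | (exists2 K, K \in cells T & open_cell K x) /\ v x != 0].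

Variable beta : R * R -> R * R.

Definition normal_component (n x : R * R) : R := dot (beta x) n.

(* beta . n on [F], the trace from inside [K], with [n] outward to [K]. *)
Definition betan K F x : R :=
  trace (outward K F) (normal_component (outward K F)) x.

(* beta . n_F on an interior edge; the side is immaterial for an admissible
   velocity. *)
Definition betanF F x : R := trace (normal F) (normal_component (normal F)) x.

(* Bounded velocity field with traces on the edges, whose normal component is
   single-valued on the interior ones. *)
Definition admissible_velocity : Prop :=
  [/\ measurable_fun (domain T) beta,
      exists C : R, forall x, domain T x -> enorm (beta x) <= C,
      forall K F, K \in cells T -> edge_set F \subset K ->
        measurable_fun (`]0, 1[ : set R) (betan K F \o edge_point F) /\
        {ae @lebesgue_measure R, forall t, t \in `]0, 1[ ->
           cvg (normal_component (outward K F)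
                  (shift (edge_point F t) (- e) (outward K F)) @[e --> 0^'+])} &
      forall F, interior_edge F ->
        {ae @lebesgue_measure R, forall t, t \in `]0, 1[ ->
           trace (normal F) (normal_component (normal F)) (edge_point F t) =
           trace (opp (normal F)) (normal_component (normal F))
             (edge_point F t)}].

(* The part of the edge [F] of [K] where beta . n < 0. *)
Definition inflow K F : set (R * R) := [set x | betan K F x < 0].

Definition inflow_datum (uin : R * R -> R) : Prop :=
  forall K F, K \in cells T -> edge_set F \subset K -> boundary_edge F ->
    (@lebesgue_measure R).-integrable
      (`]0, 1[ `&` edge_point F @^-1` inflow K F)
      (EFin \o (uin \o edge_point F)).

Definition a_h u v : R :=
  \sum_(K in cells T) int_cell K (fun x => dot (beta x) (grad u x) * v x).

Definition b_h u v : R :=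
  \sum_(K in cells T) \sum_(F | (edge_set F \subset K) && interior_edge F)
     int_edge F (fun x => betan K F x * trace (outward K F) u x
                                      * trace (outward K F) v x)
  - \sum_(F | interior_edge F)
     int_edge F (fun x => (vminus F u x * Num.max 0 (betanF F x)
                           + vplus F u x * Num.min 0 (betanF F x))
                          * (- jump F v x)).

Variable phi : 'I_(nbe T) -> R * R -> R.

Definition S_ i : set (R * R) := support (phi i).

(* [j \in neighbours E] is $j \in \mathcal{I}(E)$. *)
Definition neighbours (E : set (R * R)) : {set 'I_(nbe T)} :=
  [set j | area (S_ j `&` E) != 0%E]%SET.

Definition mass i : R := 3^-1 * fine (area (S_ i)).

Definition mass_matrix : 'M[R]_(nbe T) := diag_mx (\row_i mass i).

Definition transport_matrix : 'M[R]_(nbe T) :=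
  \matrix_(i, j) (a_h (phi j) (phi i) - b_h (phi j) (phi i)).

(* Completion of off-diagonal entries by zero row sums. *)
Definition viscosity_of (d : 'I_(nbe T) -> 'I_(nbe T) -> R) : 'M[R]_(nbe T) :=
  \matrix_(i, j) if i == j then - \sum_(k | k != i) d i k else d i j.

Definition minimum_viscosity : 'M[R]_(nbe T) :=
  let s := transport_matrix in
  viscosity_of (fun i j => Num.max 0 (Num.max (s i j) (s j i))).

Definition bilinear_viscosity : 'M[R]_(nbe T) :=
  let s := transport_matrix in
  viscosity_of (fun i j =>
    let Sij := S_ i `&` S_ j in
    if area Sij == 0%E then 0 else
    \big[Num.max/0]_(l in neighbours Sij)
      \big[Num.max/0]_(k in neighbours Sij | l != k) s l k).

Definition low_order (V : 'M[R]_(nbe T)) (dt : R) (U : 'cV[R]_(nbe T)) :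
    'cV[R]_(nbe T) :=
  (1%:M - dt *: (invmx mass_matrix *m (transport_matrix - V))) *m U.

Definition fe_function (U : 'cV[R]_(nbe T)) x : R := \sum_i U i 0 * phi i x.

Definition inflow_term (uin : R * R -> R) (U : 'cV[R]_(nbe T)) i : R :=
  \sum_(K in cells T) \sum_(F | (edge_set F \subset K) && boundary_edge F)
    int_edge_on F (inflow K F)
      (fun x => betan K F x * (trace (outward K F) (fe_function U) x - uin x)
                * trace (outward K F) (phi i) x).

Definition antidiffusive (V : 'M[R]_(nbe T)) (U : 'cV[R]_(nbe T)) i j : R :=
  - V i j * (U j 0 - U i 0).

End Mesh.

Section Limiter.
Variables (R : realType) (T : mesh R) (phi : 'I_(nbe T) -> R * R -> R).
Variables (dt : R) (UL : 'cV[R]_(nbe T)) (Umin Umax : 'I_(nbe T) -> R).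
Implicit Types i j : 'I_(nbe T).

Definition alpha (l : 'I_(nbe T) -> R) i : R :=
  if l i != 0 then
    Num.min 1
      (Num.max 0
        (Num.max (mass phi i / dt * ((Umax i - UL i 0) / l i))
                 (mass phi i / dt * ((Umin i - UL i 0) / l i))))
  else 1.

(* [Q_bound Umax] and [Q_bound Umin] are the quantities Q^+ and Q^- of flux
   corrected transport; the inflow contribution alpha_i l_i is subtracted in
   [Q_inflow]. *)
Definition Q_bound (B : 'I_(nbe T) -> R) i : R :=
  mass phi i / dt * (B i - UL i 0).

Definition Q_inflow (B l : 'I_(nbe T) -> R) i : R :=
  Q_bound B i - alpha l i * l i.

Variable t : 'I_(nbe T) -> 'I_(nbe T) -> R.

Definition P_plus i : R := \sum_(j in neighbours phi (S_ phi i)) Num.max 0 (t i j).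

Definition P_minus i : R := \sum_(j in neighbours phi (S_ phi i)) Num.min 0 (t i j).

Definition ratio (Q P : R) : R := if P != 0 then Num.min 1 (Q / P) else 1.

Definition limiter (Qp Qm : 'I_(nbe T) -> R) i j : R :=
  let Rp k := ratio (Qp k) (P_plus k) in
  let Rm k := ratio (Qm k) (P_minus k) in
  if 0 <= t i j then Num.min (Rp i) (Rm j) else Num.min (Rm i) (Rp j).

Definition limited_fluxes (c : 'I_(nbe T) -> 'I_(nbe T) -> R) i : R :=
  dt / mass phi i * \sum_(j in neighbours phi (S_ phi i)) c i j * t i j.

End Limiter.

(* Main.v *)
Require Import Defs.
From HB Require Import structures.
From mathcomp Require Import all_boot all_order all_algebra.
From mathcomp Require Import all_classical all_reals all_analysis.
Set Implicit Arguments.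
Unset Strict Implicit.
Unset Printing Implicit Defensive.
Import Order.TTheory GRing.Theory Num.Theory.
Import numFieldNormedType.Exports.
Local Open Scope classical_set_scope.
Local Open Scope ring_scope.

(** The argument is Zalesak's.  Each admissible budget [Q^+_i >= 0] (resp.
    [Q^-_i <= 0]) is the total flux that node [i] may still receive (resp. lose)
    before it leaves its bounds, once the inflow contribution [alpha_i l_i] has
    been paid for.  Two facts carry the proof.

    - [Q_inflow_sign]: as [UL] is within the bounds, an inflow term of either
      sign has room, and [alpha_i] damps it to fit,
      [m_i/dt (Umin_i - UL_i) <= alpha_i l_i <= m_i/dt (Umax_i - UL_i)].  So the
      budgets keep the signs [Q^-_i <= 0 <= Q^+_i], and the ratios [R^+_i] and
      [R^-_i] are nonnegative at every node.

    - [limited_sum_bounds]: since [0 <= l_ij <= R^+_i] when [t_ij >= 0] and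
      [0 <= l_ij <= R^-_i] otherwise, the limited fluxes at [i] sum up to at
      most [R^+_i P^+_i <= Q^+_i] and at least [R^-_i P^-_i >= Q^-_i].

    Multiplying by [dt/m_i] turns the budgets back into the bounds.  The same
    steps with [alpha_i l_i] replaced by zero give flux-corrected transport. *)

Section Ratio.
Variables (R : realType) (Q P : R).

(** Stated with [Q * P] so as to serve both for [R^+], where [Q] and [P] are
    nonnegative, and for [R^-], where they are nonpositive. *)
Lemma ratio_ge0 : 0 <= Q * P -> 0 <= Defs.ratio Q P.
Proof.
move=> QP; rewrite /Defs.ratio; case: ifP => // P0.
have -> : Q / P = Q * P / P ^+ 2 by rewrite expr2 invfM mulrA mulfK.
by rewrite le_min ler01 divr_ge0 // sqr_ge0.
Qed.

Lemma ratio_mul_le : 0 <= P -> 0 <= Q -> Defs.ratio Q P * P <= Q.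
Proof.
move=> P0 Q0; rewrite /Defs.ratio; case: eqVneq => [->|Pn0] /=;
  first by rewrite mulr0.
have P_gt0 : 0 < P by rewrite lt_neqAle eq_sym Pn0.
by rewrite -ler_pdivlMr // ge_min lexx orbT.
Qed.

Lemma ratio_mul_ge : P <= 0 -> Q <= 0 -> Q <= Defs.ratio Q P * P.
Proof.
move=> P0 Q0; rewrite /Defs.ratio; case: eqVneq => [->|Pn0] /=;
  first by rewrite mulr0.
have P_lt0 : P < 0 by rewrite lt_neqAle Pn0.
by rewrite -ler_ndivlMr // ge_min lexx orbT.
Qed.

End Ratio.

Section Limiter.
Variables (R : realType) (T : mesh R) (phi : 'I_(nbe T) -> R * R -> R).
Variables (dt : R) (UL : 'cV[R]_(nbe T)) (Umin Umax : 'I_(nbe T) -> R).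
Hypothesis dt_gt0 : 0 < dt.
Hypothesis UL_bounds : forall i, Umin i <= UL i 0 <= Umax i.
Implicit Types i j : 'I_(nbe T).

Lemma mass_ge0 i : 0 <= mass phi i.
Proof. by rewrite mulr_ge0 ?invr_ge0 ?ler0n // fine_ge0 // measure_ge0. Qed.

Lemma Q_bound_sign i :
  Q_bound phi dt UL Umin i <= 0 <= Q_bound phi dt UL Umax i.
Proof.
have k_ge0 : 0 <= mass phi i / dt by rewrite divr_ge0 ?mass_ge0 ?ltW.
have /andP[lo up] := UL_bounds i.
by rewrite mulr_ge0_le0 ?subr_le0 // mulr_ge0 ?subr_ge0.
Qed.

(** If [l i > 0], the larger of the two quotients defining [alpha] is the one
    of the upper bound, so [alpha l = min (l, Q_bound Umax)]; if [l i < 0] the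
    division reverses the order and [alpha l = max (l, Q_bound Umin)].  In both
    cases [alpha l] lies between the two values of [Q_bound]. *)
Lemma alpha_bounds (l : 'I_(nbe T) -> R) i :
  Q_bound phi dt UL Umin i <= alpha phi dt UL Umin Umax l i * l i
    <= Q_bound phi dt UL Umax i.
Proof.
have /andP[] := Q_bound_sign i; rewrite /alpha !mulrA.
rewrite -/(Q_bound phi dt UL Umax i) -/(Q_bound phi dt UL Umin i).
move: (Q_bound phi dt UL Umin i) (Q_bound phi dt UL Umax i) => A B A_le0 B_ge0.
case: (ltgtP (l i) 0) => [l_lt0|l_gt0|->] /=; last by rewrite mulr0 A_le0.
- have Bl : B / l i <= 0 by rewrite mulr_ge0_le0 // invr_le0 ltW.
  have Al : 0 <= A / l i by rewrite mulr_le0 // invr_le0 ltW.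
  rewrite (max_r (le_trans Bl Al)) (max_r Al) -ler_ndivlMr // ge_min lexx orbT.
  by rewrite (le_trans _ B_ge0) // mulr_ge0_le0 ?(ltW l_lt0) // le_min ler01.
- have Bl : 0 <= B / l i by rewrite divr_ge0 // ltW.
  have Al : A / l i <= 0 by rewrite mulr_le0_ge0 // invr_ge0 ltW.
  rewrite (max_l (le_trans Al Bl)) (max_r Bl) -ler_pdivlMr // ge_min lexx orbT.
  by rewrite andbT (le_trans A_le0) // mulr_ge0 ?(ltW l_gt0) // le_min ler01.
Qed.

Lemma Q_inflow_sign (l : 'I_(nbe T) -> R) i :
  Q_inflow phi dt UL Umin Umax Umin l i <= 0
    <= Q_inflow phi dt UL Umin Umax Umax l i.
Proof. by rewrite /Q_inflow subr_le0 subr_ge0 alpha_bounds. Qed.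

Variables (t : 'I_(nbe T) -> 'I_(nbe T) -> R) (Qp Qm : 'I_(nbe T) -> R).
Hypothesis Q_sign : forall i, Qm i <= 0 <= Qp i.

Lemma P_plus_ge0 i : 0 <= P_plus phi t i.
Proof. by apply: sumr_ge0 => j _; rewrite le_max lexx. Qed.

Lemma P_minus_le0 i : P_minus phi t i <= 0.
Proof. by apply: sumr_le0 => j _; rewrite ge_min lexx. Qed.

Lemma ratio_plus_ge0 i : 0 <= Defs.ratio (Qp i) (P_plus phi t i).
Proof.
have /andP[_ Qp_ge0] := Q_sign i.
by rewrite ratio_ge0 // mulr_ge0 // P_plus_ge0.
Qed.

Lemma ratio_minus_ge0 i : 0 <= Defs.ratio (Qm i) (P_minus phi t i).
Proof.
have /andP[Qm_le0 _] := Q_sign i.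
by rewrite ratio_ge0 // mulr_le0 // P_minus_le0.
Qed.

(** The ratio at the neighbour [j] in the limiter only matters through its sign
    here; it is the ratio at [i] itself that caps the flux received by [i]. *)
Lemma limited_flux_bounds i j :
  Defs.ratio (Qm i) (P_minus phi t i) * Num.min 0 (t i j)
    <= limiter phi t Qp Qm i j * t i j
    <= Defs.ratio (Qp i) (P_plus phi t i) * Num.max 0 (t i j).
Proof.
rewrite /limiter; case: (leP 0 (t i j)) => [t_ge0|t_lt0].
- rewrite mulr0 mulr_ge0 ?le_min ?ratio_plus_ge0 ?ratio_minus_ge0 //=.
  by rewrite ler_wpM2r // ge_min lexx.
- rewrite mulr0 mulr_ge0_le0 ?(ltW t_lt0) //;
    last by rewrite le_min ratio_plus_ge0 ratio_minus_ge0.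
  by rewrite andbT ler_wnM2r ?(ltW t_lt0) // ge_min lexx.
Qed.

Lemma limited_sum_bounds i :
  Qm i <= \sum_(j in neighbours phi (S_ phi i)) limiter phi t Qp Qm i j * t i j
    <= Qp i.
Proof.
have /andP[Qm_le0 Qp_ge0] := Q_sign i; apply/andP; split.
- apply: le_trans (ratio_mul_ge (P_minus_le0 i) Qm_le0) _.
  rewrite mulr_sumr; apply: ler_sum => j _.
  by have /andP[] := limited_flux_bounds i j.
- apply: le_trans _ (ratio_mul_le (P_plus_ge0 i) Qp_ge0).
  rewrite mulr_sumr; apply: ler_sum => j _.
  by have /andP[] := limited_flux_bounds i j.
Qed.

(** Conversion from fluxes to nodal values: an increment [x] that respects the
    budgets of node [i] keeps the update within the bounds. *)
Lemma update_bounds i (x : R) :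
  Q_bound phi dt UL Umin i <= x <= Q_bound phi dt UL Umax i ->
  Umin i <= UL i 0 + dt / mass phi i * x <= Umax i.
Proof.
rewrite /Q_bound; have := mass_ge0 i; rewrite le_eqVlt => /predU1P[<- _|m_gt0].
  (* Zero mass: [dt / 0 = 0], so the node keeps its low-order value. *)
  by rewrite invr0 mulr0 mul0r addr0.
have k_gt0 : 0 < dt / mass phi i by rewrite divr_gt0.
have -> : mass phi i / dt = (dt / mass phi i)^-1 by rewrite invf_div.
rewrite ![_^-1 * _]mulrC ler_pdivrMr // ler_pdivlMr // [x * _]mulrC.
by rewrite lerBlDl lerBrDl.
Qed.

End Limiter.

Theorem theorem4p7 (R : realType) (T : mesh R) (hT : triangulation T)
    (beta : R * R -> R * R) (hbeta : admissible_velocity T beta)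
    (phi : 'I_(nbe T) -> R * R -> R) (hphi : cr_basis phi)
    (uin : R * R -> R) (huin : inflow_datum T beta uin)
    (dt : R) (hdt : 0 < dt)
    (V : 'M[R]_(nbe T))
    (hV : V = minimum_viscosity beta phi \/ V = bilinear_viscosity beta phi)
    (U : 'cV[R]_(nbe T)) (Umin Umax : 'I_(nbe T) -> R)
    (hU : forall i, Umin i <= Umax i)
    (hlow : forall i, Umin i <= low_order beta phi V dt U i 0 <= Umax i) :
  let UL := low_order beta phi V dt U in
  let t := antidiffusive V U in
  let l := inflow_term beta phi uin U in
  let a := alpha phi dt UL Umin Umax l in
  let Qp := Q_inflow phi dt UL Umin Umax Umax l in
  let Qm := Q_inflow phi dt UL Umin Umax Umin l in
  let Qp0 := Q_bound phi dt UL Umax in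
  let Qm0 := Q_bound phi dt UL Umin in
  (forall i : 'I_(nbe T),
     Umin i
     <= UL i 0 + limited_fluxes phi dt t (limiter phi t Qp Qm) i
        + dt / mass phi i * (a i * l i)
     <= Umax i) /\
  ((forall i, l i = 0) ->
   forall i : 'I_(nbe T),
     Umin i
     <= UL i 0 + limited_fluxes phi dt t (limiter phi t Qp0 Qm0) i
     <= Umax i).
Proof.
move=> UL t l a Qp Qm Qp0 Qm0; split=> [|_] i.
- rewrite -addrA -mulrDr; apply: update_bounds => //.
  rewrite -lerBlDr -[X in _ && X]lerBrDr.
  exact: (limited_sum_bounds phi t (Q_inflow_sign phi hdt hlow l) i).
- apply: update_bounds => //.
  exact: (limited_sum_bounds phi t (Q_bound_sign phi hdt hlow) i).
Qed.
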